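(* Let $q=2^m$ where $m\ge 3$, and let $B_2=\{u\in\mathrm{GF}(q):\mathrm{Tr}(u^3-u)=1\}$. Let $\omega$ denote a primitive cube root of unity in $\mathrm{GF}(q)$ (when $m$ is even), and let $\alpha_1,\alpha_2,\alpha_3,\alpha_4$ be the roots of $x^4+x+1$ in $\mathrm{GF}(q)$ (when $4\mid m$). Then the setwise stabiliser of $B_2$ in $\mathrm{GA}_1(q)=\{x\mapsto ax+b:a\in\mathrm{GF}(q)^*,b\in\mathrm{GF}(q)\}$ is $$G_{B_2}=\begin{cases}\{x\mapsto x,\ x\mapsto x+1\} & \text{if } m\not\equiv 0\pmod 4,\\ \{x\mapsto \omega^k x+\alpha_j\omega^{-k}: k\in\{1,2\}, j\in\{1,2,3,4\}\}\cup\{x\mapsto x\}\cup\{x\mapsto x+\omega^k: k\in\{0,1,2\}\} & \text{if } m\equiv 0\pmod 4.\end{cases}$$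
   Context: $\mathrm{Tr}$ denotes the absolute trace from $\mathrm{GF}(2^m)$ to $\mathrm{GF}(2)$. *)

(* Defs.v *)
From HB Require Import structures.
From mathcomp Require Import all_boot all_order all_algebra all_fingroup.
From mathcomp Require Import all_solvable all_field.

Set Implicit Arguments.
Unset Strict Implicit.
Unset Printing Implicit Defensive.

Import GRing.Theory.
Local Open Scope ring_scope.

(* [pPrimeCharType _] is F itself, seen as an extension of its prime field    *)
(* 'F_p; the value of the trace is thus an element of F lying in the prime    *)
(* subfield.                                                                  *)
Definition abs_trace (F : finFieldType) (x : F) : F :=
  galTrace 1 {: pPrimeCharType (s2valP' (finPcharP F))} x.

Lemma abs_traceE (F : finFieldType) (m : nat) (x : F) :
  #|F| = (2 ^ m)%N -> abs_trace x = \sum_(i < m) x ^+ (2 ^ i).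
Proof.
rewrite /abs_trace; move: (s2val _) (s2valP' _) => p pchar_p cardF.
have p2 : p = 2%N.
  have c2 := card_finPcharP cardF isT.
  by move: pchar_p; rewrite (pcharf_eq c2) inE => /eqP.
subst p; set L := pPrimeCharType pchar_p.
case: (@finField_galois_generator 'F_2 L 1%AS {:L}%AS (sub1v _)) => s /eqP gen_s s_val.
have os : #[s]%g = m.
  rewrite orderE -gen_s -galois_dim ?finField_galois ?sub1v // dimv1 divn1.
  by rewrite (pprimeChar_dimf pchar_p) /= cardF pfactorK.
have sX i : (s ^+ i)%g x = x ^+ (2 ^ i) :> L.
  elim: i => [|i IHi]; first by rewrite gal_id.
  rewrite expgSr galM ?memvf // IHi s_val ?memvf // dimv1 expn1 card_Fp //.
  by rewrite -exprM -expnSr.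
have cycE : <[s]>%g = [set (s ^+ val i)%g | i : 'I_m].
  apply/setP=> t; apply/idP/imsetP => [/cyclePmin[i] | [i _ ->]].
    by rewrite os => ltim ->; exists (Ordinal ltim).
  exact: mem_cycle.
rewrite /galTrace gen_s cycE big_imset /=; last first.
  move=> i j _ _ /eqP; rewrite eq_expg_mod_order os !modn_small // => /eqP.
  exact: val_inj.
by apply: eq_bigr => i _; rewrite sX.
Qed.

Definition B2 (F : finFieldType) : {set F} :=
  [set u | abs_trace (u ^+ 3 - u) == 1].

Fact aff_inj (F : finFieldType) (a : {unit F}) (b : F) :
  injective (fun x => val a * x + b).
Proof. by move=> x y /addIr /(mulrI (valP a)). Qed.

Definition aff (F : finFieldType) (a : {unit F}) (b : F) : {perm F} :=
  perm (@aff_inj F a b).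

Definition GA1 (F : finFieldType) : {set {perm F}} :=
  [set aff a b | a : {unit F}, b : F].

(* The hypotheses of the main statement on the cube root of unity and on the  *)
(* roots of 'X^4 + 'X + 1 can be met whenever they are assumed:               *)

Lemma ex_cube_root (F : finFieldType) (m : nat) :
  #|F| = (2 ^ m)%N -> (2 %| m)%N -> exists w : {unit F}, 3.-primitive_root (val w).
Proof.
move=> cardF /dvdnP[k def_m].
have dvd3 : (3 %| #|[set: {unit F}]|)%N.
  rewrite card_finField_unit cardF def_m mulnC expnM -subn1.
  by rewrite -(eqn_mod_dvd 3) ?expn_gt0 // -modnXm exp1n.
have [//|w _ ow] := Cauchy _ dvd3; exists w.
apply/andP; split => //; apply/forallP=> i; rewrite unity_rootE -FinRing.val_unitX.
rewrite -FinRing.val_unit1 (inj_eq val_inj) -order_dvdn ow.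
by case: i => [[|[|[|]]]].
Qed.

Lemma ex_roots_X4X1 (F : finFieldType) (m : nat) :
    #|F| = (2 ^ m)%N -> (4 %| m)%N ->
  exists alpha : 'I_4 -> F,
    'X^4 + 'X + 1 = \prod_(j < 4) ('X - (alpha j)%:P).
Proof.
move=> cardF /dvdnP[k def_m].
have ch2 : 2%N \in [pchar {poly F}].
  by rewrite pchar_poly (card_finPcharP cardF).
pose p : {poly F} := 'X^4 + 'X + 1.
have frob i (a b : {poly F}) : (a + b) ^+ (2 ^ i) = a ^+ (2 ^ i) + b ^+ (2 ^ i).
  by rewrite exprDn_pchar // pnatX pnatE ?ch2.
have frobN i (a b : {poly F}) : (a - b) ^+ (2 ^ i) = a ^+ (2 ^ i) - b ^+ (2 ^ i).
  by rewrite !(oppr_pchar2 ch2) frob.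
have size_p : size p = 5.
  by rewrite /p -addrA size_polyDl ?size_polyXn // size_XaddC.
have mon_p : p \is monic.
  rewrite monicE lead_coefE size_p /p !coefE /=.
  by rewrite !addr0.
have p16 : p %| 'X^(2 ^ 4) - 'X.
  have -> : 'X^(2 ^ 4) - 'X = p ^+ 4 + p.
    rewrite {1}/p !(frob 2) expr1n -exprM (oppr_pchar2 ch2) /p.
    rewrite addrACA (addrr_pchar2 ch2) addr0 addrA -[_ + _ + 'X^4]addrA.
    by rewrite (addrr_pchar2 ch2) addr0.
  by rewrite exprS -[X in _ + X]mulr1 -mulrDr dvdp_mulr.
have pq : p %| 'X^#|F| - 'X.
  rewrite cardF def_m mulnC.
  elim: k {def_m} => [|k IHk]; first by rewrite muln0 expr1 subrr dvdp0.
  have -> : 'X^(2 ^ (4 * k.+1)) - 'X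
            = ('X^(2 ^ (4 * k)) - 'X) ^+ (2 ^ 4) + ('X^(2 ^ 4) - 'X) :> {poly F}.
    by rewrite frobN -exprM -expnD mulnSr addrA subrK.
  by rewrite dvdp_addl // exprS dvdp_mulr.
move: pq; rewrite finField_genPoly -big_enum /= => /dvdp_prod_XsubC[msk].
set s := mask _ _; rewrite eqp_monic ?monic_prod_XsubC // => /eqP def_p.
have size_s : size s == 4.
  by move: size_p; rewrite def_p size_prod_XsubC => -[->].
exists (tnth (Tuple size_s)); rewrite -/p def_p.
by rewrite -(big_tuple _ _ (Tuple size_s) xpredT (fun z => 'X - z%:P)).
Qed.

(* Main.v *)
Require Import Defs.
From mathcomp Require Import all_boot all_order all_algebra all_fingroup.
From mathcomp Require Import all_solvable all_field.
From mathcomp Require Import ring.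

Set Implicit Arguments.
Unset Strict Implicit.
Unset Printing Implicit Defensive.

Import GRing.Theory.

Local Open Scope ring_scope.

(* The map [x -> a x + b] stabilises [B2] iff the cubic
   [(a^3 - 1) u^3 + a^2 b u^2 + (a b^2 + a + 1) u + b^3 + b] has trace [0] for
   all [u].  As [q > 4], this forces the cubic coefficient to vanish, and the
   rest amounts to [b^4 + b + 1 = a] and [Tr (b^3 + b) = 0].  If [a = 1], then
   [b] lies in GF(4); otherwise [a] is a primitive cube root of unity and [b a]
   is a root of [x^4 + x + 1].  When 4 divides m the trace condition always
   holds, by transitivity of the trace through GF(16).  Otherwise every root [z]
   of [z^2 + z + 1] has nonzero trace, by transitivity through GF(4); this
   excludes [a <> 1] (take [z = y^2 + y], of trace [0], with [y = b a]) and
   leaves [b] in GF(2) when [a = 1] (take [z = b^3 + b = b + 1]). *)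

(** * Characteristic 2 and basic properties of the trace *)

Lemma poly_vanish_eq0 (F : finFieldType) (p : {poly F}) :
  (size p <= #|F|)%N -> (forall u, p.[u] = 0) -> p = 0.
Proof.
move=> size_p p0; apply: contraTeq size_p => nz_p; rewrite -ltnNge cardE.
by apply: max_poly_roots (enum_uniq _) => //; apply/allP=> u _; apply/eqP/p0.
Qed.

Lemma pchar2_natr0 (F : finFieldType) (m : nat) : #|F| = (2 ^ m)%N -> 2 = 0 :> F.
Proof. by move=> cardF; have /andP[_ /eqP] := card_finPcharP cardF isT. Qed.

(** Lets [ring], which knows nothing of the characteristic, prove identities modulo 2: [z] is the
    explicit correction that makes the identity hold over the integers. *)
Lemma pchar2_eq (F : finFieldType) (m : nat) (x y z : F) :
  #|F| = (2 ^ m)%N -> x = y + 2 * z -> x = y.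
Proof. by move=> cardF ->; rewrite (pchar2_natr0 cardF) mul0r addr0. Qed.

Lemma abs_traceD (F : finFieldType) (m : nat) (x y : F) :
  #|F| = (2 ^ m)%N -> abs_trace (x + y) = abs_trace x + abs_trace y.
Proof.
move=> cardF; rewrite !(abs_traceE _ cardF) -big_split /=.
apply: eq_bigr => i _; rewrite exprDn_pchar // pnatX pnatE //.
by rewrite (card_finPcharP cardF).
Qed.

Lemma abs_trace0 (F : finFieldType) (m : nat) :
  #|F| = (2 ^ m)%N -> abs_trace (0 : F) = 0.
Proof.
move=> cardF; rewrite (abs_traceE _ cardF) big1 // => i _.
by rewrite expr0n expn_eq0.
Qed.

Lemma abs_trace_sqr (F : finFieldType) (m : nat) (x : F) :
  #|F| = (2 ^ m)%N -> abs_trace (x ^+ 2) = abs_trace x.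
Proof.
move=> cardF; rewrite !(abs_traceE _ cardF).
case: m cardF => [|m] cardF; first by rewrite !big_ord0.
(* Squaring shifts the summands cyclically: the last one becomes [x ^+ (2 ^ m)], that is, [x]. *)
rewrite big_ord_recr big_ord_recl /= addrC -exprM -expnS -cardF expf_card.
by congr (_ + _); apply: eq_bigr => i _; rewrite -exprM -expnS.
Qed.

Lemma sqr_abs_trace (F : finFieldType) (m : nat) (x : F) :
  #|F| = (2 ^ m)%N -> abs_trace x ^+ 2 = abs_trace x.
Proof.
move=> cardF; rewrite -[RHS](abs_trace_sqr _ cardF) !(abs_traceE _ cardF).
have ch2 := card_finPcharP cardF isT.
rewrite -(pFrobenius_autE ch2) rmorph_sum /=.
by apply: eq_bigr => i _; rewrite pFrobenius_autE -!exprM mulnC.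
Qed.

(** The trace is a root of t^2 = t, hence 0 or 1. This turns invariance of [B2] into the vanishing
    of a trace. *)
Lemma eq1_abs_trace (F : finFieldType) (m : nat) (x y : F) :
    #|F| = (2 ^ m)%N ->
  (abs_trace x == 1) = (abs_trace y == 1) <-> abs_trace (x - y) = 0.
Proof.
move=> cardF; rewrite (oppr_pchar2 (card_finPcharP cardF isT)).
rewrite (abs_traceD _ _ cardF).
have tr01 z : (abs_trace z == 0 :> F) || (abs_trace z == 1).
  rewrite -[_ == 1]subr_eq0 -mulf_eq0 mulrBr mulr1 -expr2.
  by rewrite (sqr_abs_trace _ cardF) subrr.
have two0 := pchar2_natr0 cardF.
have := tr01 x; have := tr01 y.
move=> /orP[]/eqP-> /orP[]/eqP->;
  rewrite ?addr0 ?add0r ?eqxx ?(eq_sym 0 1) ?oner_eq0;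
  split => // /eqP; rewrite ?oner_eq0 //.
Qed.

(** If c were nonzero, c v^2 would run over the whole field, since squaring is bijective. The trace
    would then vanish identically, although it is a nonzero polynomial of degree less than q. *)
Lemma abs_trace_nondegenerate (F : finFieldType) (m : nat) (c : F) :
  #|F| = (2 ^ m)%N -> (forall u, abs_trace (c * u ^+ 2) = 0) -> c = 0.
Proof.
move=> cardF trc0; apply/eqP; apply: wlog_neg => nz_c.
have m_gt0 : (0 < m)%N.
  by rewrite lt0n; apply: contraTneq (finNzRing_gt1 F) => m0; rewrite cardF m0.
have tr0 (u : F) : abs_trace u = 0.
  have [v ->] : exists v, u = c * v ^+ 2.
    (* The square root of u / c, by the inverse Frobenius. *)
    exists ((u / c) ^+ (2 ^ m.-1)).
    by rewrite -exprM -expnSr prednK // -cardF expf_card mulrC divfK.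
  exact: trc0.
pose p : {poly F} := \sum_(i < m) 'X^(2 ^ i).
(* The contradiction comes from the coefficient of X, which is 1: only the summand i = 0
   contributes. *)
have/polyP/(_ 1%N)/eqP : p = 0.
  apply: poly_vanish_eq0 => [|u]; last first.
    rewrite -[RHS](tr0 u) (abs_traceE _ cardF) horner_sum.
    by apply: eq_bigr => i _; rewrite hornerXn.
  apply/leq_sizeP => j; rewrite cardF => le_j; rewrite coef_sum big1 // => i _.
  by rewrite coefXn gtn_eqF // (leq_trans _ le_j) // ltn_exp2l.
rewrite coef_sum -(prednK m_gt0) big_ord_recl coefXn big1 ?addr0 /= => [|i _].
  by rewrite coef0 oner_eq0.
by rewrite coefXn expnS; case: (2 ^ i)%N => [|[]].
Qed.

(** * Transitivity of the trace through GF(16) and GF(4) *)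

Lemma abs_trace_tower (F : finFieldType) (d t : nat) (x : F) :
    #|F| = (2 ^ (d * t))%N ->
  abs_trace x = \sum_(j < t) (\sum_(i < d) x ^+ (2 ^ i)) ^+ (2 ^ (d * j)).
Proof.
move=> cardF; have ch2 := card_finPcharP cardF isT; rewrite (abs_traceE _ cardF).
elim: t {cardF} => [|t IHt]; first by rewrite muln0 !big_ord0.
(* Split off the last block of d exponents; it is the image of the inner sum under an additive
   Frobenius power. *)
rewrite mulnSr big_split_ord /= IHt big_ord_recr /=; congr (_ + _).
elim/big_rec2: _ => [|i y z _ ->]; first by rewrite expr0n expn_eq0.
by rewrite exprDn_pchar ?pnatX ?pnatE ?ch2 // -exprM -expnD addnC.
Qed.

Lemma abs_trace_GF16 (F : finFieldType) (m : nat) (x : F) :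
    #|F| = (2 ^ m)%N -> (4 %| m)%N ->
  x + x ^+ 2 + x ^+ 4 + x ^+ 8 = 0 -> abs_trace x = 0.
Proof.
move=> cardF /dvdnP[t def_m] x0; rewrite def_m mulnC in cardF.
rewrite (abs_trace_tower _ cardF) big1 // => j _.
by rewrite !big_ord_recr big_ord0 /= add0r expr1 x0 expr0n expn_eq0.
Qed.

(** Here z + z^2 = 1. For odd m this would give Tr(1) = 0, whereas Tr(1) = m = 1. For even m the
    trace is a sum of m/2 blocks equal to 1, and m/2 is odd. *)
Lemma abs_trace_cube_root_neq0 (F : finFieldType) (m : nat) (z : F) :
    #|F| = (2 ^ m)%N -> ~~ (4 %| m)%N ->
  z ^+ 2 + z + 1 = 0 -> abs_trace z != 0.
Proof.
move=> cardF not4m z0; have t2 := pchar2_natr0 cardF.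
have natrE n : n%:R = (odd n)%:R :> F.
  by rewrite -[in LHS](odd_double_half n) natrD -muln2 natrM t2 mulr0 addr0.
have z1 : z + z ^+ 2 = 1.
  by apply: (pchar2_eq (z := -1) cardF); rewrite -[LHS]subr0 -[in LHS]z0; ring.
have even_m : ~~ odd m.
  apply/negP=> odd_m; have: abs_trace (1 : F) = 0.
    rewrite -z1 (abs_traceD _ _ cardF) (abs_trace_sqr _ cardF).
    by rewrite -mulr2n -mulr_natl t2 mul0r.
  rewrite (abs_traceE _ cardF); under eq_bigr do rewrite expr1n.
  by rewrite sumr_const card_ord natrE odd_m => /eqP; rewrite oner_eq0.
have def_m : m = (2 * m./2)%N by rewrite mul2n even_halfK.
rewrite def_m in cardF; rewrite (abs_trace_tower _ cardF).
under eq_bigr do rewrite !big_ord_recr big_ord0 /= add0r expr1 z1 expr1n.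
rewrite sumr_const card_ord natrE.
case: (boolP (odd m./2)) => [_|even_m2]; first exact: oner_neq0.
by case/negP: not4m; rewrite def_m -[m./2]even_halfK // -mul2n mulnA dvdn_mulr.
Qed.

(** * The equations characterising the stabiliser *)

Lemma abs_trace_cubic_eq0 (F : finFieldType) (m : nat) (c d e h : F) :
    #|F| = (2 ^ m)%N -> (3 <= m)%N ->
    (forall u, abs_trace (c * u ^+ 3 + d * u ^+ 2 + e * u + h) = 0) <->
  [/\ c = 0, d = e ^+ 2 & abs_trace h = 0].
Proof.
move=> cardF m_ge3; have trD x y := abs_traceD x y cardF; have trX x := abs_trace_sqr x cardF.
have addxx (x : F) : x + x = 0 := addrr_pchar2 (card_finPcharP cardF isT) x.
split=> [tr0|[-> -> tr_h] u]; last first.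
  by rewrite mul0r add0r !trD tr_h addr0 -exprMn trX addxx.
have tr_h : abs_trace h = 0.
  by have := tr0 0; rewrite !expr0n /= !mulr0 !add0r.
have tr3 u : abs_trace (c * u ^+ 3) + abs_trace (d * u ^+ 2) + abs_trace (e * u) = 0.
  by have := tr0 u; rewrite !trD tr_h addr0.
have c0 : c = 0.
  (* Polarising the cubic form [Tr(c u^3)] gives [Tr(c u^2 v) + Tr(c u v^2)],
     whose first term is [Tr(c^2 u^4 v^2)]. *)
  have quartic u : c ^+ 2 * u ^+ 4 + c * u = 0.
    apply: (abs_trace_nondegenerate cardF) => v.
    have -> : (c ^+ 2 * u ^+ 4 + c * u) * v ^+ 2 = (c * u ^+ 2 * v) ^+ 2 + c * u * v ^+ 2.
      by ring.
    rewrite trD trX -trD.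
    pose P x := c * x ^+ 3 + d * x ^+ 2 + e * x.
    have trP x : abs_trace (P x) = 0 by rewrite !trD.
    have -> : c * u ^+ 2 * v + c * u * v ^+ 2 = P (u + v) + P u + P v.
      by apply: (pchar2_eq (z := - (c * u ^+ 2 * v + c * u * v ^+ 2 + d * u * v + P u + P v))
        cardF); rewrite /P; ring.
    by rewrite 2!trD !trP !addr0.
  apply/eqP; apply: wlog_neg => nz_c.
  (* This polynomial has degree at most 4, while q is at least 8 because m >= 3; vanishing
     everywhere, it is zero. *)
  have: c ^+ 2 *: 'X^4 + c *: 'X = 0 :> {poly F}.
    apply: poly_vanish_eq0 => [|u]; last by rewrite hornerD !hornerZ hornerXn hornerX.
    rewrite cardF (@leq_trans (2 ^ 3)) ?leq_exp2l //.
    rewrite (leq_trans (size_polyD _ _)) // geq_max.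
    by rewrite !(leq_trans (size_scale_leq _ _)) ?size_polyXn ?size_polyX.
  move/polyP/(_ 1%N); rewrite !coefE /= mulr0 mulr1 add0r => /eqP.
  by rewrite (negPf nz_c).
(* As Tr(e u) = Tr(e^2 u^2), what remains is Tr((d + e^2) u^2) = 0 for all u. *)
split=> //; apply/eqP; rewrite -subr_eq0 (oppr_pchar2 (card_finPcharP cardF isT)).
apply/eqP/(abs_trace_nondegenerate cardF) => u.
by rewrite mulrDl trD -exprMn trX; have := tr3 u; rewrite c0 mul0r (abs_trace0 cardF) add0r.
Qed.

(** These are the conditions of [abs_trace_cubic_eq0] for the difference [diffE]. The two forms of
    the equation in b differ by a factor x^2, invertible since x^3 = 1. *)
Lemma aff_astabs_B2 (F : finFieldType) (m : nat) (a : {unit F}) (b : F) :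
    #|F| = (2 ^ m)%N -> (3 <= m)%N ->
  (aff a b \in 'N(B2 F | 'P))%g <->
  [/\ val a ^+ 3 = 1, b ^+ 4 + b + 1 = val a & abs_trace (b ^+ 3 + b) = 0].
Proof.
move=> cardF m_ge3; set x := val a.
have -> : [/\ x ^+ 3 = 1, b ^+ 4 + b + 1 = x & abs_trace (b ^+ 3 + b) = 0] <->
    [/\ x ^+ 3 - 1 = 0, x ^+ 2 * b = (x * b ^+ 2 + x + 1) ^+ 2
      & abs_trace (b ^+ 3 + b) = 0].
  split=> -[x3 bx trb]; split=> //.
  - by rewrite x3 subrr.
  - apply: (pchar2_eq (z := x ^+ 2 * b - 1 - x ^+ 2 * b ^+ 2 - x * b ^+ 2 - x) cardF).
    have xx : x ^+ 2 * (b ^+ 4 + b + 1) = 1 by rewrite bx -exprSr.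
    by rewrite -[LHS]addr0 -(subrr 1) -{1}xx; ring.
  - exact/subr0_eq.
  - apply: (pchar2_eq (z := b - x - x * (x ^+ 2 * b ^+ 2 + x * b ^+ 2 + x)) cardF).
    have z : (x ^+ 3 - 1) * (b ^+ 4 + 1 - b) = 0 by rewrite x3 mul0r.
    have bx0 : x * ((x * b ^+ 2 + x + 1) ^+ 2 - x ^+ 2 * b) = 0 by rewrite bx subrr mulr0.
    by rewrite -[LHS]addr0 -[in LHS]z -[LHS]subr0 -[in LHS]bx0; ring.
rewrite -(abs_trace_cubic_eq0 _ _ _ _ cardF m_ge3).
have diffE u : (x * u + b) ^+ 3 - (x * u + b) - (u ^+ 3 - u) =
    (x ^+ 3 - 1) * u ^+ 3 + x ^+ 2 * b * u ^+ 2 + (x * b ^+ 2 + x + 1) * u + (b ^+ 3 + b).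
  apply: (pchar2_eq (z := x ^+ 2 * b * u ^+ 2 + x * b ^+ 2 * u - x * u - b) cardF).
  ring.
split=> [/astabsP stab u|tr0].
  by have := stab u; rewrite !inE /= apermE permE => /(eq1_abs_trace _ _ cardF); rewrite diffE.
apply/astabsP => u; rewrite !inE /= apermE permE; apply/(eq1_abs_trace _ _ cardF).
by rewrite diffE.
Qed.

Theorem theorem20 (F : finFieldType) (m : nat)
    (w : {unit F}) (alpha : 'I_4 -> F) :
    #|F| = (2 ^ m)%N ->
    (3 <= m)%N ->
    ((2 %| m)%N -> 3.-primitive_root (val w)) ->
    ((4 %| m)%N -> 'X^4 + 'X + 1 = \prod_(j < 4) ('X - (alpha j)%:P)) ->
  'N_(GA1 F)(B2 F | 'P)%g =
    if (4 %| m)%N then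
      [set aff (w ^+ val k)%g (alpha j * val (w ^- val k)%g)
         | k : 'I_3 in predC1 ord0, j : 'I_4]
      :|: [set aff 1%g 0]
      :|: [set aff 1%g (val (w ^+ val k)%g) | k : 'I_3]
    else [set aff 1%g 0; aff 1%g 1].
Proof.
move=> cardF m_ge3 w3 alphaP.
have astabs_aff a b := aff_astabs_B2 a b cardF m_ge3.
(* Proof by certificate: [t] is a combination of relations known to vanish, [z] the correction
   modulo 2. *)
have lin_comb (x y z t : F) : t = 0 -> x = y + t + 2 * z -> x = y.
  by move=> -> /(pchar2_eq cardF); rewrite addr0.
have cube1 (x : F) : x ^+ 3 = 1 -> x != 1 -> x ^+ 2 + x + 1 = 0.
  move=> x3 x1; apply/eqP; have: (x - 1) * (x ^+ 2 + x + 1) == 0.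
    by have -> : (x - 1) * (x ^+ 2 + x + 1) = x ^+ 3 - 1; [ring | rewrite x3 subrr].
  by rewrite mulf_eq0 subr_eq0 (negPf x1).
have translation (b : F) : b ^+ 4 + b + 1 = 1 -> b = 0 \/ b ^+ 3 = 1.
  move=> b1; have: b * (b ^+ 3 - 1) == 0.
    apply/eqP/(lin_comb _ _ (- b) (b ^+ 4 + b + 1 - 1)); last by ring.
    by rewrite b1 subrr.
  by rewrite mulf_eq0 subr_eq0 => /orP[]/eqP; [left|right].
have rotation (a b : F) : a ^+ 3 = 1 -> a != 1 -> b ^+ 4 + b + 1 = a ->
    (b * a) ^+ 4 + b * a + 1 = 0.
  (* Since a^4 = a, the left side is a(b^4 + b) + 1 = a(a + 1) + 1. *)
  move=> a3 a1 ab.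
  apply: (lin_comb _ _ (- a) (a * (b ^+ 4 + b + 1 - a) + (a ^+ 3 - 1) * (a * b ^+ 4)
    + (a ^+ 2 + a + 1))); last by ring.
  by rewrite ab a3 (cube1 a a3 a1) !subrr mulr0 mul0r !addr0.
have unit_neq0 (u : {unit F}) : val u != 0 by rewrite -unitfE; apply: valP.
case: ifPn => [m4|not_m4].
  have {w3}w3 := w3 (dvdn_trans (isT : 2 %| 4)%N m4); have {}alphaP := alphaP m4.
  have w3X (k : nat) : val (w ^+ k)%g ^+ 3 = 1.
    by rewrite FinRing.val_unitX exprAC (prim_expr_order w3) expr1n.
  have wP (a : F) : a ^+ 3 = 1 -> exists k : 'I_3, a = val (w ^+ k)%g.
    by case/(prim_rootP w3) => k ->; exists k; rewrite FinRing.val_unitX.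
  have alphaE x : x ^+ 4 + x + 1 = 0 <-> exists j, x = alpha j.
    have -> : x ^+ 4 + x + 1 = \prod_(j < 4) (x - alpha j).
      have := congr1 (horner^~ x) alphaP; rewrite !hornerE horner_prod => ->.
      by apply: eq_bigr => j _; rewrite !hornerE.
    split=> [/eqP/prodf_eq0[j _]|[j ->]]; first by rewrite subr_eq0 => /eqP; exists j.
    by rewrite (bigD1 j) //= subrr mul0r.
  apply/setP=> s; rewrite !in_setU in_setI in_set1; apply/idP/idP.
    case/andP=> /imset2P[a b _ _ ->] /astabs_aff[a3 ab _].
    have [a1|a_neq1] := eqVneq (val a) 1.
      have def_a : a = 1%g by apply: val_inj.
      rewrite {a}def_a in a3 ab a1 *.
      have [->|/wP[k ->]] := translation b ab; first by rewrite eqxx orbT.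
      by apply/orP; right; apply/imsetP; exists k.
    have [k def_a] := wP _ a3; have {}def_a : a = (w ^+ k)%g by apply: val_inj.
    have [j ba] := (alphaE _).1 (rotation _ _ a3 a_neq1 ab).
    apply/orP; left; apply/orP; left; apply/imset2P; exists k j => //.
      by rewrite !inE; apply: contraNneq a_neq1 => k0; rewrite def_a k0.
    by rewrite -def_a -ba; congr aff; apply/esym/(mulfK (unit_neq0 a)).
  rewrite -orbA => /or3P[/imset2P[k j k0 _ ->]|/eqP->|/imsetP[k _ ->]];
    rewrite imset2_f //=.
  - apply: (astabs_aff _ (alpha j / val (w ^+ k)%g)).2.
    have a3 := w3X k; move: (unit_neq0 (w ^+ k)%g).
    have a1 : val (w ^+ k)%g != 1.
      rewrite FinRing.val_unitX -(prim_order_dvd w3) gtnNdvd //.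
      by rewrite lt0n; move: k0; rewrite !inE.
    set a := val _ in a3 a1 *; set r := alpha j => nz_a.
    have r0 : r ^+ 4 + r + 1 = 0 by apply/alphaE; exists j.
    have c0 := cube1 a a3 a1.
    have -> : a^-1 = a ^+ 2 by apply: (mulIf nz_a); rewrite mulVf // -exprSr.
    split=> //.
      apply: (lin_comb _ _ 1 (a ^+ 2 * (r ^+ 4 + r + 1)
        + r ^+ 4 * a ^+ 2 * (a ^+ 3 + 1) * (a ^+ 3 - 1) - (a ^+ 2 + a + 1))); last by ring.
      by rewrite r0 c0 a3 subrr !mulr0 subr0 addr0.
    have -> : (r * a ^+ 2) ^+ 3 + r * a ^+ 2 = r ^+ 3 + r * a ^+ 2.
      by rewrite exprMn exprAC a3 expr1n mulr1.
    (* With s = x + x^4, the trace of x from GF(16) to GF(4), the sum to kill is s + s^2. Here s =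
       r^2 + r + 1 + a^2, so s + s^2 = (r^4 + r) + (a^2 + a) = 1 + 1. *)
    apply: (abs_trace_GF16 cardF m4); set x := r ^+ 3 + _.
    have r4 : r ^+ 4 = r + 1.
      by apply: (lin_comb _ _ (- (r + 1)) _ r0); ring.
    have x4 : x ^+ 4 = (r + 1) ^+ 3 + (r + 1) * a ^+ 2.
      apply: (pchar2_eq (z := 2 * (r ^+ 3) ^+ 3 * (r * a ^+ 2)
        + 3 * (r ^+ 3) ^+ 2 * (r * a ^+ 2) ^+ 2 + 2 * r ^+ 3 * (r * a ^+ 2) ^+ 3) cardF).
      have a8 : a ^+ 8 = a ^+ 2.
        by rewrite (exprD a 6 2) (exprM a 3 2) a3 expr1n mul1r.
      have -> : (r + 1) ^+ 3 + (r + 1) * a ^+ 2 = (r ^+ 4) ^+ 3 + r ^+ 4 * a ^+ 8.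
        by rewrite r4 a8.
      by rewrite /x; ring.
    have xx4 : x + x ^+ 4 = r ^+ 2 + r + 1 + a ^+ 2.
      apply: (pchar2_eq (z := r ^+ 3 + r * a ^+ 2 + r ^+ 2 + r) cardF).
      by rewrite x4 /x; ring.
    apply: (pchar2_eq (z := - x ^+ 5) cardF).
    transitivity ((x + x ^+ 4) + (x + x ^+ 4) ^+ 2 + 2 * - x ^+ 5); first by ring.
    congr (_ + _); rewrite xx4.
    apply: (lin_comb _ _ (r ^+ 3 + r ^+ 2 + r ^+ 2 * a ^+ 2 + r + r * a ^+ 2 + a ^+ 2
      + r ^+ 2) ((r ^+ 4 + r + 1) + (a ^+ 3 - 1) * a + (a ^+ 2 + a + 1))); last by ring.
    by rewrite r0 c0 a3 subrr mul0r !addr0.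
  - by apply/astabs_aff; rewrite expr1n !expr0n !add0r (abs_trace0 cardF).
  - apply: (astabs_aff _ (val (w ^+ k)%g)).2.
    have := w3X k; move: (val (w ^+ k)%g) => b b3; rewrite expr1n b3.
    have b4 : b ^+ 4 = b by rewrite exprS b3 mulr1.
    split=> //.
      change (b ^+ 4 + b + 1 = 1).
      by apply: (pchar2_eq (z := b) cardF); rewrite b4; ring.
    apply: (abs_trace_GF16 cardF m4); set x := 1 + b.
    (* x lies in GF(4), so each term of the GF(16) trace occurs twice. *)
    have x4 : x ^+ 4 = x.
      apply: (lin_comb _ _ (2 * b + 3 * b ^+ 2 + 2 * b ^+ 3) (b ^+ 4 - b)).
        by rewrite b4 subrr.
      by rewrite /x; ring.
    apply: (pchar2_eq (z := x + x ^+ 2) cardF).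
    by rewrite (exprM x 4 2) x4; ring.
have no_cube_root z := abs_trace_cube_root_neq0 (z := z) cardF not_m4.
apply/setP=> s; rewrite in_setI in_set2; apply/idP/idP.
  case/andP=> /imset2P[a b _ _ ->] /astabs_aff[a3 ab trb].
  have [a1|a_neq1] := eqVneq (val a) 1.
    have def_a : a = 1%g by apply: val_inj.
    rewrite {a}def_a in ab a1 a3 *.
    have [->|b3] := translation b ab; first by rewrite eqxx.
    have [->|b_neq1] := eqVneq b 1; first by rewrite eqxx orbT.
    suff z0 : (b ^+ 3 + b) ^+ 2 + (b ^+ 3 + b) + 1 = 0.
      by have := no_cube_root _ z0; rewrite trb eqxx.
    rewrite b3; apply: (lin_comb _ _ (b + 1) _ (cube1 b b3 b_neq1)); ring.
  have y0 := rotation _ _ a3 a_neq1 ab; set y := b * _ in y0.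
  (* Modulo 2 the left side is y^4 + y + 1. *)
  have z0 : (y ^+ 2 + y) ^+ 2 + (y ^+ 2 + y) + 1 = 0.
    by apply: (lin_comb _ _ (y ^+ 3 + y ^+ 2) _ y0); ring.
  have := no_cube_root _ z0; rewrite (abs_traceD _ _ cardF) (abs_trace_sqr _ cardF).
  by rewrite (addrr_pchar2 (card_finPcharP cardF isT)) eqxx.
case/orP=> /eqP->; rewrite imset2_f //=; apply/astabs_aff.
  by rewrite expr1n !expr0n !add0r (abs_trace0 cardF).
rewrite !expr1n (pchar2_natr0 cardF : 1 + 1 = 0) add0r (abs_trace0 cardF).
by split.
Qed.
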